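(* Let $f:\mathbb{R}^n\to\mathbb{R}$ be locally Lipschitz continuous. Then the single-valued map $G:\mathbb{R}^n\times(0,+\infty)\to\mathbb{R}^n$ defined by $G(x,\epsilon)=\operatorname{argmin}_{v\in\partial^{\rm G}_\epsilon f(x)}\|v\|$, where $$\partial^{\rm G}_\epsilon f(x)=\operatorname{conv}\Big(\bigcup\{\partial f(z)\mid \|z-x\|\le\epsilon\}\Big)$$ is the Goldstein $\epsilon$-subdifferential, is a descent-oriented subdifferential for $f$.
   Context: $\|\cdot\|$ is the Euclidean norm; $\mathbb{N}=\{0,1,2,\dots\}$; $\partial f$ is the Clarke subdifferential; $\operatorname{conv}$ is the convex hull. A single-valued map is treated as a singleton-valued set-valued map. Set limits (Painlevé–Kuratowski). For a sequence of sets $\{C^k\}$ in $\mathbb{R}^n$, the outer limit $\limsup_{k\to+\infty}C^k$ is the set of all $u$ for which there are an infinite $N\subset\mathbb{N}$ and $u^k\in C^k$ ($k\in N$) with $u^k\to u$ as $k\to\infty$, $k\in N$; the inner limit $\liminf_{k\to+\infty}C^k$ is defined in the same way with $N\subset\mathbb{N}$ having finite complement. If the two coincide, their common value is $\lim_{k\to+\infty}C^k$. For sets $A_\epsilon$ ($\epsilon>0$), $\lim_{\epsilon\downarrow0}A_\epsilon=C$ means $\lim_{k\to+\infty}A_{\epsilon_k}=C$ for every sequence $\epsilon_k>0$ with $\epsilon_k\to0$. For $G:\mathbb{R}^n\times(0,+\infty)\rightrightarrows\mathbb{R}^n$: $\limsup_{x\to\bar x}G(x,\epsilon)$ ($\epsilon$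 fixed) is the union of $\limsup_{k\to+\infty}G(x^k,\epsilon)$ over all sequences $x^k\to\bar x$ ($x^k=\bar x$ is allowed); $\limsup_{\epsilon\downarrow0,\,x\to\bar x}G(x,\epsilon)$ is the union of $\limsup_{k\to+\infty}G(x^k,\epsilon_k)$ over all sequences $x^k\to\bar x$ and $\epsilon_k>0$ with $\epsilon_k\to0$. Definition. $G$ is a descent-oriented subdifferential for $f$ if for each fixed $\epsilon>0$ the mapping $G(\cdot,\epsilon)$ is closed-valued and locally bounded (every $\bar x$ has a neighborhood $V$ with $\bigcup_{x\in V}G(x,\epsilon)$ bounded), and for all $\bar x\in\mathbb{R}^n$: (G1) $\limsup_{\epsilon\downarrow0,\,x\to\bar x}G(x,\epsilon)\subset\partial f(\bar x)$; (G2) $\lim_{\epsilon\downarrow0}\big(\limsup_{x\to\bar x}G(x,\epsilon)\big)=\operatorname{argmin}_{v\in\partial f(\bar x)}\|v\|$ (the singleton consisting of the minimal norm element of $\partial f(\bar x)$). *)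

(* Defs.v *)
From HB Require Import structures.
From mathcomp Require Import all_boot all_order all_algebra.
From mathcomp Require Import all_classical all_reals all_analysis.

Set Implicit Arguments.
Unset Strict Implicit.
Unset Printing Implicit Defensive.

Import Order.TTheory GRing.Theory Num.Theory.
Import numFieldNormedType.Exports.

Local Open Scope classical_set_scope.
Local Open Scope ring_scope.

(* The norm that the library puts on ['rV[R]_n] is the max norm.  It is used
   here only through the topology and the bounded sets it induces, which are
   the usual ones of the Euclidean space; every norm that occurs in a formula is
   the Euclidean norm [enorm]. *)

Section Euclidean.
Context {R : realType} {n : nat}.
Implicit Types (u v : 'rV[R]_n) (A : set 'rV[R]_n).

Definition dotp u v : R := \sum_(i < n) u 0 i * v 0 i.

Definition enorm v : R := Num.sqrt (dotp v v).

Definition argmin_norm A : set 'rV[R]_n :=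
  [set v | A v /\ forall w, A w -> enorm v <= enorm w].

Definition conv_hull A : set 'rV[R]_n := smallest (@convex_set R 'rV[R]_n) A.

End Euclidean.

Section Subdifferentials.
Context {R : realType} {n : nat}.
Implicit Types (f : 'rV[R]_n -> R) (x v : 'rV[R]_n).

Definition locally_lipschitz f : Prop :=
  forall x, exists L : R, exists2 V, nbhs x V &
    forall y z, V y -> V z -> `|f y - f z| <= L * enorm (y - z).

(* Upper limit of (f (y + t v) - f y) / t as y -> x and t -> 0, t > 0; it is
   finite as soon as f is Lipschitz near x. *)
Definition clarke_dirderiv f x v : \bar R :=
  limf_esup (fun p : 'rV[R]_n * R => ((f (p.1 + p.2 *: v) - f p.1) / p.2)%:E)
            (filter_prod (nbhs x) 0^'+).

Definition clarke_subdiff f x : set 'rV[R]_n :=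
  [set xi | forall v, ((dotp xi v)%:E <= clarke_dirderiv f x v)%E].

Definition goldstein_subdiff f (eps : R) x : set 'rV[R]_n :=
  conv_hull (\bigcup_(z in [set z | enorm (z - x) <= eps]) clarke_subdiff f z).

Definition goldstein_min_norm f x (eps : R) : set 'rV[R]_n :=
  argmin_norm (goldstein_subdiff f eps x).

End Subdifferentials.

Section SetLimits.
Context {R : realType} {n : nat}.
Implicit Types (C : nat -> set 'rV[R]_n) (G : 'rV[R]_n -> R -> set 'rV[R]_n).

Definition outer_limit C : set 'rV[R]_n :=
  [set u | exists2 N : set nat, infinite_set N &
     exists2 w : nat -> 'rV[R]_n, (forall k, N k -> C k (w k)) &
       w @ within N \oo --> u].

Definition inner_limit C : set 'rV[R]_n :=
  [set u | exists2 N : set nat, finite_set (~` N) &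
     exists2 w : nat -> 'rV[R]_n, (forall k, N k -> C k (w k)) &
       w @ within N \oo --> u].

Definition set_limit C (L : set 'rV[R]_n) : Prop :=
  outer_limit C = L /\ inner_limit C = L.

Definition set_limit_eps0 (A : R -> set 'rV[R]_n) (L : set 'rV[R]_n) : Prop :=
  forall e : nat -> R, (forall k, 0 < e k) -> e @ \oo --> 0 ->
    set_limit (fun k => A (e k)) L.

Definition limsup_x G (xbar : 'rV[R]_n) (eps : R) : set 'rV[R]_n :=
  [set u | exists2 x : nat -> 'rV[R]_n, x @ \oo --> xbar &
     outer_limit (fun k => G (x k) eps) u].

Definition limsup_eps0_x G (xbar : 'rV[R]_n) : set 'rV[R]_n :=
  [set u | exists x : nat -> 'rV[R]_n, exists e : nat -> R,
     [/\ x @ \oo --> xbar, forall k, 0 < e k, e @ \oo --> 0 &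
         outer_limit (fun k => G (x k) (e k)) u]].

End SetLimits.

Section DescentOriented.
Context {R : realType} {n : nat}.

(* A mapping on R^n x (0, +oo) is represented by a mapping on R^n x R of which
   only the values at positive second arguments matter. *)
Record descent_oriented (f : 'rV[R]_n -> R)
    (G : 'rV[R]_n -> R -> set 'rV[R]_n) : Prop := DescentOriented {
  do_closed : forall eps : R, 0 < eps ->
    forall x : 'rV[R]_n, closed (G x eps);
  do_locally_bounded : forall eps : R, 0 < eps ->
    forall xbar : 'rV[R]_n, exists2 V : set 'rV[R]_n,
      nbhs xbar V & bounded_set (\bigcup_(x in V) G x eps);
  do_G1 : forall xbar : 'rV[R]_n,
    limsup_eps0_x G xbar `<=` clarke_subdiff f xbar;
  do_G2 : forall xbar : 'rV[R]_n,
    set_limit_eps0 (limsup_x G xbar) (argmin_norm (clarke_subdiff f xbar))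
}.

End DescentOriented.

(* Main.v *)
Require Import Defs.
From HB Require Import structures.
From mathcomp Require Import all_boot all_order all_algebra.
From mathcomp Require Import all_classical all_reals all_analysis.
From mathcomp Require Import lra.
Import Order.TTheory GRing.Theory Num.Theory.
Import numFieldNormedType.Exports.
Local Open Scope classical_set_scope.
Local Open Scope ring_scope.

(** The Clarke directional derivative [p := f°(x; .)] of a locally Lipschitz
    [f] is sublinear and finite, it is upper semicontinuous in [x], and the
    subdifferential at [x] is the set of the linear functionals below [p].
    Hahn-Banach then shows that [p(v)] is the maximum of [<xi, v>] over the
    subdifferential ([clarke_subdiff_max]), which is therefore nonempty; upper
    semicontinuity makes its graph closed ([closed_clarke_graph]), and the
    local Lipschitz constants bound it on bounded sets
    ([clarke_subdiff_bounded]).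

    The union of the subdifferentials over a closed ball is thus compact, and
    Caratheodory's theorem makes its convex hull, the Goldstein
    subdifferential, compact too ([compact_conv_hull]).  So an element of
    minimal norm exists; it is unique by the first-order condition
    [<v, v> <= <v, w>] ([argmin_norm_dotp]), and it is locally bounded because
    the whole Goldstein subdifferential is.

    Both limit conditions rest on one estimate ([goldstein_halfspace]): if
    [f°(x; v) < a], then for small [e] and [z] near [x] the Goldstein
    [e]-subdifferential at [z] lies in the half-space [<., v> <= a], as the
    nearby Clarke subdifferentials do and the half-space is convex.  Letting
    [v] and [a] vary puts the outer limits for [e -> 0] and [z -> x] in the
    subdifferential at [x].

    For the limit of the outer limits at fixed [e], let [g] be the element of
    minimal norm of the subdifferential at [x].  The first-order condition and
    the maximum formula give [f°(x; -g) <= -|g|^2], so that the elements [w] of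
    the Goldstein [e]-subdifferential at [z] satisfy [<w, g> >= |g|^2 - b] with
    [b] arbitrarily small.  If [w] is the one of minimal norm, then also
    [|w| <= |g|] once [|z - x| <= e], because [g] belongs to the Goldstein
    [e]-subdifferential at [z].  Hence [|w - g|^2 <= 2 b]
    ([goldstein_min_norm_near]). *)

(** * Euclidean space *)

Section Euclid.
Set Implicit Arguments.
Unset Strict Implicit.
Context {R : realType} {n : nat}.
Implicit Types (u v w x y : 'rV[R]_n) (A K V : set 'rV[R]_n).

Lemma dotpC u v : dotp u v = dotp v u.
Proof. by apply: eq_bigr => i _; rewrite mulrC. Qed.

Lemma dotpDr u v w : dotp u (v + w) = dotp u v + dotp u w.
Proof.
by rewrite /dotp -big_split; apply: eq_bigr => i _; rewrite mxE mulrDr.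
Qed.

Lemma dotpZr a u v : dotp u (a *: v) = a * dotp u v.
Proof.
by rewrite /dotp mulr_sumr; apply: eq_bigr => i _; rewrite mxE mulrCA.
Qed.

Lemma dotpDl u v w : dotp (u + v) w = dotp u w + dotp v w.
Proof. by rewrite dotpC dotpDr !(dotpC w). Qed.

Lemma dotpZl a u v : dotp (a *: u) v = a * dotp u v.
Proof. by rewrite dotpC dotpZr dotpC. Qed.

Lemma dotpNr u v : dotp u (- v) = - dotp u v.
Proof. by rewrite -scaleN1r dotpZr mulN1r. Qed.

Lemma dotpNl u v : dotp (- u) v = - dotp u v.
Proof. by rewrite dotpC dotpNr dotpC. Qed.

Definition dotpE := (dotpDr, dotpDl, dotpZr, dotpZl, dotpNr, dotpNl).

Lemma dotp_ge0 u : 0 <= dotp u u.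
Proof. by apply: sumr_ge0 => i _; rewrite -expr2 sqr_ge0. Qed.

Lemma enorm_ge0 u : 0 <= enorm u.
Proof. exact: sqrtr_ge0. Qed.

Lemma enorm_sqr u : enorm u ^+ 2 = dotp u u.
Proof. by rewrite sqr_sqrtr ?dotp_ge0. Qed.

Lemma le_enorm u v : (enorm u <= enorm v) = (dotp u u <= dotp v v).
Proof. by rewrite ler_sqrt ?dotp_ge0. Qed.

Lemma enormN u : enorm (- u) = enorm u.
Proof. by rewrite /enorm dotpNl dotpNr opprK. Qed.

Lemma enormZ a u : enorm (a *: u) = `|a| * enorm u.
Proof.
by rewrite /enorm dotpZl dotpZr mulrA -expr2 sqrtrM ?sqr_ge0// sqrtr_sqr.
Qed.

Lemma dotp_eq0 u : dotp u u = 0 -> u = 0.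
Proof.
move=> u0; apply/rowP => i; rewrite mxE.
have /(_ i isT)/eqP := psumr_eq0P (fun i _ => sqr_ge0 (u 0 i)) u0.
by rewrite mulf_eq0 orbb => /eqP.
Qed.

(** Expand [0 <= | |v| u - |u| v |^2] into
    [0 <= 2 |u| |v| (|u| |v| - <u, v>)]. *)
Lemma dotp_le_enorm u v : dotp u v <= enorm u * enorm v.
Proof.
have d0 w : dotp 0 w = 0 by rewrite -(scale0r w) dotpZl mul0r.
have pos w : w != 0 -> 0 < enorm w.
  rewrite lt0r enorm_ge0 andbT; apply: contraNneq => w0.
  by apply/eqP/dotp_eq0; rewrite -enorm_sqr w0 expr0n.
have [->|/pos u0] := eqVneq u 0; first by rewrite d0 mulr_ge0 ?enorm_ge0.
have [->|/pos v0] := eqVneq v 0.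
  by rewrite dotpC d0 mulr_ge0 ?enorm_ge0.
have := dotp_ge0 (enorm v *: u - enorm u *: v).
rewrite !dotpE -!enorm_sqr (dotpC v u) => h.
have : 0 <= 2 * (enorm u * enorm v) * (enorm u * enorm v - dotp u v) by lra.
by rewrite pmulr_rge0 ?subr_ge0// !mulr_gt0.
Qed.

Lemma ler_enormD u v : enorm (u + v) <= enorm u + enorm v.
Proof.
rewrite -(@ler_pXn2r _ 2) ?nnegrE ?addr_ge0 ?enorm_ge0//.
rewrite enorm_sqr !dotpE (dotpC v u) sqrrD !enorm_sqr.
by have := dotp_le_enorm u v; lra.
Qed.

Lemma mx_norm_le_enorm u : `|u| <= enorm u.
Proof.
rewrite [leLHS]/Num.norm/= mx_normrE; apply/bigmax_leP; split=> [|[i j] _ /=].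
  exact: enorm_ge0.
rewrite (ord1 i) -sqrtr_sqr ler_wsqrtr// /dotp (bigD1 j)//= -expr2 lerDl.
by apply: sumr_ge0 => k _; rewrite -expr2 sqr_ge0.
Qed.

Lemma dotp_cvg (T : Type) (F : set_system T) {FF : Filter F}
    (f g : T -> 'rV[R]_n) u v :
  f @ F --> u -> g @ F --> v -> dotp (f x) (g x) @[x --> F] --> dotp u v.
Proof.
move=> fu gv; apply: cvg_big => [|i _]; first exact: add_continuous.
apply: cvgM; first exact: (cvg_comp _ _ fu (@coord_continuous _ _ _ 0 i u)).
exact: (cvg_comp _ _ gv (@coord_continuous _ _ _ 0 i v)).
Qed.

Lemma dotp_continuousl v : continuous (fun u => dotp u v).
Proof.
move=> u; apply: (@dotp_cvg _ (nbhs u) _ id (fun=> v)); last exact: cvg_cst.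
exact: cvg_id.
Qed.

Lemma enorm_cvg (T : Type) (F : set_system T) {FF : Filter F}
    (f : T -> 'rV[R]_n) u :
  f @ F --> u -> enorm (f x) @[x --> F] --> enorm u.
Proof.
move=> fu.
have := cvg_comp _ _ (dotp_cvg fu fu) (@sqrt_continuous R (dotp u u)).
exact.
Qed.

Lemma enormB_cvg x y : enorm (z - x) @[z --> y] --> enorm (y - x).
Proof.
have : z - x @[z --> y] --> y - x; last by move=> /enorm_cvg; apply.
apply: (@cvgD _ 'rV[R]_n _ (nbhs y) _ id (fun=> - x)); last exact: cvg_cst.
exact: cvg_id.
Qed.

Lemma enorm0 : enorm (0 : 'rV[R]_n) = 0.
Proof. by rewrite -(scale0r 0) enormZ normr0 mul0r. Qed.

Lemma enorm_near x (e : R) : 0 < e -> \forall y \near x, enorm (y - x) < e.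
Proof.
move=> e0; have := @enormB_cvg x x.
rewrite subrr enorm0.
by move=> /cvgr_lt; apply.
Qed.

Lemma nbhs_eball x V : nbhs x V ->
  exists2 r : R, 0 < r & forall y, enorm (y - x) <= r -> V y.
Proof.
move=> /nbhs_normP[r /= r0 rV]; exists (r / 2); first by rewrite divr_gt0.
move=> y yx; apply: rV => /=; rewrite distrC.
by apply: le_lt_trans (mx_norm_le_enorm _) _; lra.
Qed.

Lemma eball_compact x (r : R) : compact [set y | enorm (y - x) <= r].
Proof.
apply: bounded_closed_compact.
  exists (`|x| + r); split; first exact: num_real.
  move=> M /ltW xM y /= yx; apply: le_trans xM.
  rewrite -[y](subrK x) addrC; apply: le_trans (ler_normD _ _) _.
  by rewrite lerD2l (le_trans (mx_norm_le_enorm _)).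
apply: (preimage_closed _ (@closed_le _ r)) => y _.
exact: enormB_cvg.
Qed.

End Euclid.

(** * Convex sets and elements of minimal norm *)

Section Convex.
Set Implicit Arguments.
Unset Strict Implicit.
Context {R : realType} {n : nat}.
Implicit Types (u v w x y : 'rV[R]_n) (A K V : set 'rV[R]_n).

Lemma convex_setP A : @convex_set R 'rV[R]_n A <->
  forall x y t, 0 <= t <= 1 -> A x -> A y -> A (t *: x + (1 - t) *: y).
Proof.
split=> [cA x y t t01 Ax Ay|cA x y t].
  have := cA x y (Itv01 (andP t01).1 (andP t01).2).
  by rewrite !inE; apply.
by rewrite !inE => Ax Ay; apply: cA => //; rewrite ge0 le1.
Qed.

Lemma convex_eball (r : R) : @convex_set R 'rV[R]_n [set v | enorm v <= r].
Proof.
apply/convex_setP => x y t /andP[t0 t1] /= xr yr.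
apply: le_trans (ler_enormD _ _) _; rewrite !enormZ !ger0_norm ?subr_ge0//.
by nra.
Qed.

Lemma convex_halfspace v (a : R) :
  @convex_set R 'rV[R]_n [set u | dotp u v <= a].
Proof.
by apply/convex_setP => x y t /andP[t0 t1] /= xr yr; rewrite !dotpE; nra.
Qed.

Lemma sub_conv_hull A : A `<=` conv_hull A.
Proof. exact: sub_smallest. Qed.

Lemma conv_hull_sub A B :
  @convex_set R 'rV[R]_n B -> A `<=` B -> conv_hull A `<=` B.
Proof. by move=> cB AB; exact: smallest_sub. Qed.

Lemma conv_hull_convex A : @convex_set R 'rV[R]_n (conv_hull A).
Proof.
apply/convex_setP => x y t t01 Ax Ay B [cB AB].
by move/convex_setP: (cB); apply => //; [exact: Ax|exact: Ay].
Qed.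

(** Only the part of [A] in a closed ball matters, and it is compact. *)
Lemma argmin_norm_closed A : closed A -> A !=set0 -> argmin_norm A !=set0.
Proof.
move=> cA [a Aa].
have cK : compact (A `&` [set y | enorm (y - 0) <= enorm a]).
  by rewrite setIC; apply: compact_closedI; [exact: eball_compact|].
have K0 : A `&` [set y | enorm (y - 0) <= enorm a] !=set0.
  by exists a; split => //=; rewrite subr0.
have [|c] := compact_EVT_min K0 cK (f := enorm).
  apply: continuous_subspaceT => y.
  by have /enorm_cvg : id z @[z --> (y : 'rV[R]_n)] --> (y : 'rV[R]_n)
    by exact: cvg_id.
rewrite inE => -[Ac _] cmin; exists c; split => // w Aw.
have [wa|/ltW aw] := leP (enorm w) (enorm a).
  by apply: cmin; rewrite inE; split => //=; rewrite subr0.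
by apply: le_trans aw; apply: cmin; rewrite inE; split => //=; rewrite subr0.
Qed.

(** First-order optimality: [t |-> |v + t (w - v)|^2] is minimal at [t = 0]
    on [[0, 1]], so its derivative [2 (<v, w> - <v, v>)] there is nonnegative. *)
Lemma argmin_norm_dotp A v w : @convex_set R 'rV[R]_n A ->
  argmin_norm A v -> A w -> dotp v v <= dotp v w.
Proof.
move=> /convex_setP cA [Av vmin] Aw; rewrite leNgt; apply/negP => vw.
set d := dotp v v - dotp v w; set q := dotp (w - v) (w - v).
have d0 : 0 < d by rewrite subr_gt0.
have q0 : 0 <= q by exact: dotp_ge0.
have h t : 0 <= t <= 1 -> 2 * t * d <= t * t * q.
  move=> t01; have := vmin _ (cA w v t t01 Aw Av).
  rewrite le_enorm /d /q !dotpE (dotpC w v); lra.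
(* the step [t := d / (d + q)] is short enough for [t^2 q <= t d] *)
have dq : 0 < d + q by lra.
have t01 : 0 <= d / (d + q) <= 1.
  apply/andP; split; first by apply: divr_ge0; lra.
  by rewrite ler_pdivrMr// mul1r; lra.
have := h _ t01; set t := d / _.
have t0 : 0 < t by rewrite divr_gt0.
move=> ht; have h1 : 2 * d <= t * q by rewrite -(ler_pM2l t0); lra.
have : t * q <= d by rewrite /t mulrAC ler_pdivrMr//; nra.
by lra.
Qed.

(** If [|w| <= |g|] and [<g, g> <= <g, w>], then
    [|w - g|^2 = |w|^2 - 2 <g, w> + |g|^2 <= 0]. *)
Lemma argmin_norm_set1 A g : @convex_set R 'rV[R]_n A -> argmin_norm A g ->
  argmin_norm A = [set g].
Proof.
move=> cA Ag; apply/seteqP; split=> [w [Aw wmin]|w ->//].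
have gw := argmin_norm_dotp cA Ag Aw.
have wg := wmin _ Ag.1; rewrite le_enorm in wg.
apply/eqP; rewrite -subr_eq0; apply/eqP/dotp_eq0/eqP.
rewrite eq_le dotp_ge0 andbT !dotpE (dotpC w g); lra.
Qed.

End Convex.

(** * Caratheodory's theorem and compact convex hulls *)

Section Caratheodory.
Set Implicit Arguments.
Unset Strict Implicit.
Context {R : realType} {n : nat}.
Implicit Types (u v w x y : 'rV[R]_n) (A K V : set 'rV[R]_n).

Definition convex_comb K m : set 'rV[R]_n :=
  [set u | exists (l : 'I_m -> R) (x : 'I_m -> 'rV[R]_n),
    [/\ forall i, 0 <= l i, \sum_i l i = 1, forall i, K (x i)
      & u = \sum_i l i *: x i]].

Lemma convex_convex_comb K : @convex_set R 'rV[R]_n (\bigcup_m convex_comb K m).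
Proof.
apply/convex_setP => u v t /andP[t0 t1].
move=> [m _ [l [x [l0 l1 Kx ->]]]] [p _ [k [y [k0 k1 Ky ->]]]].
exists (m + p)%N => //.
exists (fun i : 'I_(m + p) => match fintype.split i with
  inl i => t * l i | inr i => (1 - t) * k i end).
exists (fun i : 'I_(m + p) => match fintype.split i with
  inl i => x i | inr i => y i end).
have L (i : 'I_m) : fintype.split (lshift p i) = inl i.
  exact: (unsplitK (inl i)).
have S (i : 'I_p) : fintype.split (rshift m i) = inr i.
  exact: (unsplitK (inr i)).
split.
- move=> i; case: (fintype.split i) => j; apply: mulr_ge0 => //.
  by rewrite subr_ge0.
- rewrite big_split_ord /=.
  under eq_bigr do rewrite L; under [X in _ + X]eq_bigr do rewrite S.
  by rewrite -!mulr_sumr l1 k1; lra.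
- by move=> i; case: (fintype.split i) => j.
- rewrite big_split_ord /=.
  under [in RHS]eq_bigr do rewrite L -scalerA.
  under [X in _ = _ + X]eq_bigr do rewrite S -scalerA.
  by rewrite -!scaler_sumr.
Qed.

(** With more than [n + 1] points, the points [(1, x i)] of the space of
    dimension [n + 1] are linearly dependent.  Moving the weights along a
    dependency [c] keeps both their sum and the barycenter, and the first weight
    to vanish can be dropped. *)
Lemma convex_comb_drop K m : (n < m)%N ->
  convex_comb K m.+1 `<=` convex_comb K m.
Proof.
move=> nm u [l [x [l0 l1 Kx ->]]].
pose M : 'M[R]_(m.+1, 1 + n) := row_mx (const_mx 1) (\matrix_i x i).
have : kermx M != 0.
  rewrite -mxrank_eq0 mxrank_ker -lt0n subn_gt0.
  by apply: leq_ltn_trans (rank_leq_col M) _; rewrite add1n ltnS.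
move=> /rowV0Pn[c /sub_kermxP]; rewrite mul_mx_row => /eqP.
rewrite row_mx_eq0 => /andP[/eqP c1 /eqP cx] c0.
have sc : \sum_i c 0 i = 0.
  have /rowP/(_ 0) := c1; rewrite !mxE => sc; rewrite -[RHS]sc.
  by apply: eq_bigr => i _; rewrite !mxE mulr1.
have sx : \sum_i c 0 i *: x i = 0.
  rewrite -[RHS]cx; apply/rowP => j; rewrite mxE summxE.
  by apply: eq_bigr => i _; rewrite !mxE.
have [i0 ci0] : exists i, 0 < c 0 i.
  apply/existsP; apply: contraNT c0 => /existsPn nc.
  have {}nc i : 0 <= - c 0 i by rewrite oppr_ge0 leNgt nc.
  have := @psumr_eq0P R 'I_m.+1 predT (fun i => - c 0 i) (fun i _ => nc i).
  rewrite sumrN sc oppr0 => /(_ erefl) cz.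
  by apply/eqP/rowP => i; rewrite mxE -[LHS]opprK cz ?oppr0.
(* [j] is the index of the first weight of [l - t c] to vanish as [t] grows *)
pose j := [arg min_(i < i0 | 0 < c 0 i) (l i / c 0 i)]%O.
have [cj jmin] : 0 < c 0 j /\ forall i, 0 < c 0 i -> l j / c 0 j <= l i / c 0 i.
  by rewrite /j; case: arg_minP => // i ci imin; split.
pose t := l j / c 0 j.
have t0 : 0 <= t by rewrite divr_ge0// ltW.
pose k i := l i - t * c 0 i.
have k0 i : 0 <= k i.
  rewrite subr_ge0; have [ci|ci] := ltP 0 (c 0 i).
    by rewrite -ler_pdivlMr//; exact: jmin.
  by apply: le_trans (l0 i); rewrite mulr_ge0_le0.
have kj : k j = 0 by rewrite /k /t divfK ?subrr// gt_eqF.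
have k1 : \sum_i k i = 1 by rewrite sumrB l1 -mulr_sumr sc mulr0 subr0.
have kx : \sum_i l i *: x i = \sum_i k i *: x i.
  under [RHS]eq_bigr do rewrite scalerBl -scalerA.
  by rewrite sumrB -scaler_sumr sx scaler0 subr0.
exists (fun i => k (lift j i)), (fun i => x (lift j i)); split => //.
- by rewrite -k1 [RHS](bigD1_ord j)//= kj add0r.
- by rewrite kx (bigD1_ord j)//= kj scale0r add0r.
Qed.

(** The convex combinations of [m + 1] points of [K], built by joining one point
    at a time: each step is a continuous image of a product, so that compactness
    is inherited from [K]. *)
Fixpoint join_hull K m : set 'rV[R]_n :=
  if m is m'.+1 then
    (fun p : R * ('rV[R]_n * 'rV[R]_n) => p.1 *: p.2.1 + (1 - p.1) *: p.2.2) @`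
      (`[0, 1] `*` (join_hull K m' `*` K))
  else K.

Lemma join_hullS K m : join_hull K m `<=` join_hull K m.+1.
Proof.
have K0 x : join_hull K m x -> exists y, K y.
  by elim: m x => [x Kx|m _ x [[t [a b]] /= [_ [_ Kb]] _]]; [exists x|exists b].
move=> x Kx; have [y Ky] := K0 _ Kx; exists (1, (x, y)) => /=.
  by split => //=; rewrite in_itv/= ler01 lexx.
by rewrite subrr scale0r scale1r addr0.
Qed.

Lemma join_hull_le K m p : (m <= p)%N -> join_hull K m `<=` join_hull K p.
Proof.
move=> /subnK <-; elim: (p - m)%N => [//|d IH].
by rewrite addSn; apply: subset_trans IH _; exact: join_hullS.
Qed.

Lemma join_hull_sub K m : join_hull K m `<=` conv_hull K.
Proof.
elim: m => [|m IH]; first exact: sub_conv_hull.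
move=> _ [[t [a b]] /= [t01 [Ka Kb]] <-].
move/convex_setP: (@conv_hull_convex _ _ K); apply.
- by move: t01; rewrite in_itv.
- exact: IH.
- exact: sub_conv_hull.
Qed.

Lemma join_hull_compact K m : compact K -> compact (join_hull K m).
Proof.
move=> cK; elim: m => [//|m IH].
apply: continuous_compact; last first.
  by apply: compact_setX; [exact: segment_compact|exact: compact_setX].
apply: continuous_subspaceT => p.
have h1 : q.1 @[q --> p] --> p.1 by exact: cvg_fst.
have h2 : q.2 @[q --> p] --> p.2 by exact: cvg_snd.
have h3 : q.2.1 @[q --> p] --> p.2.1.
  by apply: (cvg_comp _ _ h2); exact: cvg_fst.
have h4 : q.2.2 @[q --> p] --> p.2.2.
  by apply: (cvg_comp _ _ h2); exact: cvg_snd.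
apply: (@cvgD R 'rV[R]_n); first exact: cvgZ.
apply: cvgZ => //; apply: cvgB => //; exact: cvg_cst.
Qed.

(** Split off the last point and divide the other weights by their sum
    [1 - s]. *)
Lemma convex_comb_join K m : convex_comb K m.+1 `<=` join_hull K m.
Proof.
elim: m => [|m IH] u [l [x [l0 l1 Kx ->]]].
  by move: l1; rewrite !big_ord1 => ->; rewrite scale1r.
rewrite big_ord_recr /= in l1; rewrite big_ord_recr.
set s := l ord_max in l1 *.
have l1' : \sum_(i < m.+1) l (widen_ord (leqnSn _) i) = 1 - s.
  by apply/eqP; rewrite eq_sym subr_eq l1.
have s1 : s <= 1 by rewrite -subr_ge0 -l1' sumr_ge0.
pose w := widen_ord (leqnSn m.+1); rewrite -/w in l1' *.
(* when the last point has all the weight, any point of [K] can be joined *)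
have [se|sn] := eqVneq s 1.
  exists (0, (x ord_max, x ord_max)) => /=.
    split; first by rewrite /= in_itv/= lexx ler01.
    by split => //; apply: (@join_hull_le K 0 m).
  have lz i : l (w i) = 0.
    have z : \sum_(i < m.+1) l (w i) = 0 by rewrite l1' se subrr.
    exact: (psumr_eq0P (fun i _ => l0 (w i)) z).
  rewrite scale0r add0r subr0 se big1 ?add0r// => i _.
  by rewrite -/(w i) lz scale0r.
have s0 : 0 < 1 - s by rewrite subr_gt0 lt_neqAle sn.
exists (1 - s, (\sum_i (l (w i) / (1 - s)) *: x (w i), x ord_max)) => /=.
  split; first by rewrite /= in_itv/= ltW//= gerBl l0.
  split => //=; apply: IH.
  exists (fun i => l (w i) / (1 - s)), (x \o w); split => //.
  - by move=> i; apply: divr_ge0; [exact: l0|exact: ltW].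
  - by rewrite -mulr_suml l1' divff ?gt_eqF.
  - by move=> i; exact: Kx.
rewrite subKr scaler_sumr; congr (_ + _); apply: eq_bigr => i _.
by rewrite scalerA mulrC divfK ?gt_eqF.
Qed.

Lemma convex_comb_join_n K m : convex_comb K m `<=` join_hull K n.
Proof.
elim: m => [|m IH] u Ku.
  case: Ku => l [x [_ + _ _]]; rewrite big_ord0 => /eqP.
  by rewrite eq_sym oner_eq0.
have [mn|nm] := leqP m n; last exact/IH/convex_comb_drop.
exact/(join_hull_le mn)/convex_comb_join.
Qed.

(** [n + 1] points are enough, since more points can be dropped one by one. *)
Lemma conv_hullE K : conv_hull K = join_hull K n.
Proof.
apply/seteqP; split; last exact: join_hull_sub.
apply: (@subset_trans _ (\bigcup_m convex_comb K m)).
  apply: conv_hull_sub; first exact: convex_convex_comb.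
  move=> x Kx; exists 1%N => //; exists (fun=> 1), (fun=> x); split => //.
  - by rewrite big_ord1.
  - by rewrite big_ord1 scale1r.
by move=> u [m _]; exact: convex_comb_join_n.
Qed.

Lemma compact_conv_hull K : compact K -> compact (conv_hull K).
Proof. by rewrite conv_hullE; exact: join_hull_compact. Qed.

End Caratheodory.

(** * The Hahn-Banach theorem in finite dimension *)

Section HahnBanach.
Set Implicit Arguments.
Unset Strict Implicit.
Context {R : realType} {n : nat}.
Implicit Types (u v w x y : 'rV[R]_n) (p q : 'rV[R]_n -> R).

Definition sublinear p : Prop :=
  (forall v w, p (v + w) <= p v + p w) /\
  (forall s v, 0 < s -> p (s *: v) <= s * p v).

Lemma sublinear0 p : sublinear p -> p 0 = 0.
Proof.
move=> [_ pZ]; have := pZ 2 0 ltac:(lra); have := pZ 2^-1 0 ltac:(lra).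
by rewrite !scaler0; lra.
Qed.

Lemma sublinear_oppr p v : sublinear p -> - p (- v) <= p v.
Proof.
move=> sp; have := sp.1 v (- v); rewrite subrr (sublinear0 sp); lra.
Qed.

(** Take [q w := inf_(t >= 0) (p (w + t v) - t p v)].  The bound at [- v] comes
    from [t = 1]; as [- q (- v) <= q v], it forces [q v = p v] and makes [q]
    linear along [v]. *)
Lemma sublinear_linear_along p v : sublinear p ->
  exists q, [/\ sublinear q, forall w, q w <= p w & q (- v) <= - p v].
Proof.
move=> sp; have [pD pZ] := sp.
pose E w := [set p (w + t *: v) - t * p v | t in [set t | 0 <= t]].
have E0 w : E w !=set0 by exists (p (w + 0 *: v) - 0 * p v); exists 0 => /=.
have El w : has_lbound (E w).
  exists (- p (- w)) => _ [t /= t0 <-].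
  have := pD (w + t *: v) (- w); rewrite addrAC subrr add0r.
  have [{}t0|tn] := ltP 0 t; last first.
    have -> : t = 0 by apply/eqP; rewrite eq_le tn.
    by rewrite !scale0r !addr0 (sublinear0 sp); lra.
  have := pZ t^-1 (t *: v); rewrite invr_gt0 => /(_ t0).
  by rewrite scalerA mulVf ?gt_eqF// scale1r mulrC ler_pdivlMr//; lra.
have le_q w t : 0 <= t -> inf (E w) <= p (w + t *: v) - t * p v.
  by move=> t0; apply: ge_inf => //; exists t.
have ge_q w a :
    (forall t, 0 <= t -> a <= p (w + t *: v) - t * p v) -> a <= inf (E w).
  by move=> h; apply: lb_le_inf => // _ [t t0 <-]; exact: h.
exists (fun w => inf (E w)); split.
- split=> [w1 w2|s w s0].
    rewrite -lerBlDr; apply: (ge_q) => t1 t10; rewrite lerBlDr -lerBlDl.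
    apply: (ge_q) => t2 t20; rewrite lerBlDl.
    apply: le_trans (le_q _ (t1 + t2) _) _; first exact: addr_ge0.
    by rewrite scalerDl addrACA; have := pD (w1 + t1 *: v) (w2 + t2 *: v); lra.
  rewrite -ler_pdivrMl//; apply: (ge_q) => t t0; rewrite ler_pdivrMl//.
  apply: le_trans (le_q _ (s * t) _) _; first by rewrite mulr_ge0// ltW.
  by rewrite -scalerA -scalerDr; have := pZ s (w + t *: v) s0; lra.
- by move=> w; have := le_q w 0 (lexx _); rewrite scale0r addr0 mul0r subr0.
- have := le_q (- v) 1 ler01.
  by rewrite scale1r addNr (sublinear0 sp) mul1r sub0r.
Qed.

(** Processing the vectors one after the other is harmless: a smaller sublinear
    functional remains linear along the vectors already treated. *)
Lemma sublinear_linear_along_seq (s : seq 'rV[R]_n) p : sublinear p ->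
  exists q, [/\ sublinear q, forall w, q w <= p w &
    forall v, v \in s -> q (- v) <= - q v].
Proof.
elim: s p => [|v s IH] p sp; first by exists p.
have [p1 [sp1 p1p p1v]] := sublinear_linear_along v sp.
have [q [sq qp1 qs]] := IH _ sp1; exists q; split=> // [w|w].
  exact: le_trans (p1p w).
rewrite inE => /predU1P[->|/qs//].
have := qp1 (- v); have := qp1 v; have := p1p v; lra.
Qed.

(** Making [p] linear along [v] keeps its value there; making the result linear
    along the canonical basis then makes it linear altogether. *)
Lemma Hahn_Banach_rV p v : sublinear p ->
  exists xi, (forall w, dotp xi w <= p w) /\ dotp xi v = p v.
Proof.
move=> sp; have [p1 [sp1 p1p p1v]] := sublinear_linear_along v sp.
have [q [sq qp1 qe]] :=
  sublinear_linear_along_seq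
    [seq delta_mx 0 i : 'rV[R]_n | i <- enum 'I_n] sp1.
have [qD qZ] := sq.
have qce c i : q (c *: delta_mx 0 i) <= c * q (delta_mx 0 i).
  have [c0|c0|->] := ltgtP c 0; last 2 first.
  - exact: qZ.
  - by rewrite scale0r mul0r (sublinear0 sq).
  have := qZ (- c) (- delta_mx 0 i).
  rewrite scaleNr scalerN opprK oppr_gt0 => /(_ c0) h.
  have /qe h' : delta_mx 0 i \in [seq delta_mx 0 i : 'rV[R]_n | i <- enum 'I_n].
    by apply: map_f; rewrite mem_enum.
  by nra.
pose xi : 'rV[R]_n := \row_i q (delta_mx 0 i).
(* one inequality for all [w] is enough: replacing [w] by [- w] gives the
   other *)
have le_xi w : q w <= dotp xi w.
  rewrite [X in q X](row_sum_delta w) /dotp.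
  elim/big_ind2 : _ => [|x a y b xa yb|i _].
  - by rewrite (sublinear0 sq).
  - by apply: le_trans (qD _ _) _; exact: lerD.
  - by rewrite mxE mulrC; exact: qce.
have xi_le w : dotp xi w <= q w.
  by have := le_xi (- w); rewrite !dotpE; have := sublinear_oppr w sq; lra.
exists xi; split=> [w|].
  exact: le_trans (xi_le w) (le_trans (qp1 w) (p1p w)).
apply/eqP; rewrite eq_le (le_trans (xi_le v) (le_trans (qp1 v) (p1p v)))/=.
have := xi_le (- v); rewrite !dotpE; have := qp1 (- v); lra.
Qed.

End HahnBanach.

(** * The Clarke subdifferential *)

Section Clarke.
Set Implicit Arguments.
Unset Strict Implicit.
Context {R : realType} {n : nat}.
Implicit Types (f : 'rV[R]_n -> R) (u v w x y z xi : 'rV[R]_n) (a b r t : R).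

(** The bounds [a] for which this holds form an up-set that determines the upper
    limit of the difference quotients; reasoning with them avoids extended
    reals and filters. *)
Definition quot_le f x v a : Prop :=
  exists2 r : R, 0 < r & forall y t, enorm (y - x) <= r -> 0 < t <= r ->
    f (y + t *: v) - f y <= t * a.

Lemma quot_le_dirderiv f x v a :
  quot_le f x v a -> (clarke_dirderiv f x v <= a%:E)%E.
Proof.
move=> [r r0 h].
pose V := [set p : 'rV[R]_n * R | enorm (p.1 - x) < r /\ 0 < p.2 < r].
apply: (@le_trans _ _ (ereal_sup
  [set ((f (p.1 + p.2 *: v) - f p.1) / p.2)%:E | p in V])).
  apply: ereal_inf_lbound; exists V => //.
  exists ([set y | enorm (y - x) < r], [set t | 0 < t < r]) => /=.
    split; first exact: enorm_near.
    near=> t; apply/andP; split; first by near: t; exact: nbhs_right_gt.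
    by near: t; exact: nbhs_right_lt.
  by move=> [y t] /= [].
apply: ge_ereal_sup => _ [[y t] /= [yx /andP[t0 tr]] <-].
by rewrite lee_fin ler_pdivrMr// mulrC; apply: h; rewrite ?t0/= ltW.
Unshelve. all: by end_near. Qed.

Lemma dirderiv_lt_quot f x v a :
  (clarke_dirderiv f x v < a%:E)%E -> quot_le f x v a.
Proof.
move=> /ereal_inf_lt[_ [V [[V1 V2] /= [V1x V20] V12V] <-] Va].
have [r1 r10 rV1] := nbhs_eball V1x.
have [r2 /= r20 rV2] := V20.
exists (Num.min r1 (r2 / 2)); first by rewrite lt_min r10 divr_gt0.
move=> y t; rewrite !le_min => /andP[yr _] /andP[t0 /andP[_ tr]].
rewrite mulrC -ler_pdivrMr// -lee_fin; apply: le_trans (ltW Va).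
apply: ereal_sup_ubound; exists (y, t) => //=.
apply: V12V; split => /=; first exact: rV1.
apply: rV2 => //=; rewrite sub0r normrN gtr0_norm//; lra.
Qed.

Lemma clarke_subdiffP f x xi : clarke_subdiff f x xi <->
  forall v a, quot_le f x v a -> dotp xi v <= a.
Proof.
split=> [h v a q|h v].
  by rewrite -lee_fin; apply: le_trans (h v) (quot_le_dirderiv q).
rewrite leNgt; apply/negP => lt.
have [a ca ad] : exists2 a, (clarke_dirderiv f x v < a%:E)%E & a < dotp xi v.
  move: lt; case: (clarke_dirderiv f x v) => [c||]; rewrite ?lte_fin => lt.
  - by exists ((c + dotp xi v) / 2); rewrite ?lte_fin; lra.
  - by [].
  - by exists (dotp xi v - 1); [exact: ltNyr|lra].
by have := h _ _ (dirderiv_lt_quot ca); lra.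
Qed.

Lemma convex_clarke_subdiff f x : @convex_set R 'rV[R]_n (clarke_subdiff f x).
Proof.
apply/convex_setP => u w t t01 /clarke_subdiffP hu /clarke_subdiffP hw.
apply/clarke_subdiffP => v a q.
have /convex_setP := @convex_halfspace R n v a.
by apply => //=; [exact: hu|exact: hw].
Qed.

(** This openness in [x] is the upper semicontinuity of the directional
    derivative. *)
Lemma quot_le_near f x v a : quot_le f x v a ->
  exists2 r, 0 < r & forall z, enorm (z - x) <= r -> quot_le f z v a.
Proof.
move=> [r r0 h]; exists (r / 2); first lra.
move=> z zx; exists (r / 2); first lra.
move=> y t yz /andP[t0 tr]; apply: h; last by rewrite t0/=; lra.
by have := ler_enormD (y - z) (z - x); rewrite addrA subrK; lra.
Qed.

Lemma quot_leW f x v a b : a <= b -> quot_le f x v a -> quot_le f x v b.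
Proof.
move=> ab [r r0 h]; exists r => // y t yx t0r.
by apply: le_trans (h _ _ yx t0r) _; rewrite ler_pM2l//; case/andP: t0r.
Qed.

(** The quotient along [v + w] at [y] is the sum of the quotient along [v] at
    [y + t w] and the quotient along [w] at [y]. *)
Lemma quot_leD f x v w a b :
  quot_le f x v a -> quot_le f x w b -> quot_le f x (v + w) (a + b).
Proof.
move=> [r r0 hv] [s s0 hw].
have w0 : 0 < enorm w + 1 by have := enorm_ge0 w; lra.
pose d := Num.min (r / 2 / (enorm w + 1)) (Num.min (r / 2) s).
exists d; first by rewrite !lt_min !divr_gt0.
move=> y t; rewrite !le_min => /and3P[_ yr ys] /and4P[t0 tw tr ts].
have h1 := hw y t ys; rewrite t0 ts in h1; move: (h1 isT) => {}h1.
have yw : enorm (y + t *: w - x) <= r.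
  rewrite addrAC; apply: le_trans (ler_enormD _ _) _.
  rewrite enormZ gtr0_norm//; move: tw; rewrite ler_pdivlMr//; nra.
have h2 := hv _ t yw; rewrite t0/= in h2.
have {}h2 := h2 ltac:(lra).
by move: h2; rewrite -addrA -scalerDr (addrC w v); lra.
Qed.

Lemma quot_leZ f x v a s :
  0 < s -> quot_le f x v a -> quot_le f x (s *: v) (s * a).
Proof.
move=> s0 [r r0 h].
exists (Num.min r (r / s)); first by rewrite lt_min r0 divr_gt0.
move=> y t; rewrite !le_min => /andP[yr _] /and3P[t0 _ ts].
have := h y (t * s) yr; rewrite scalerA mulrA; apply.
by rewrite mulr_gt0//= -ler_pdivlMr.
Qed.

Definition lipschitz_near f x L : Prop :=
  exists2 r, 0 < r & forall y z, enorm (y - x) <= r -> enorm (z - x) <= r ->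
    `|f y - f z| <= L * enorm (y - z).

Lemma locally_lipschitz_near f : locally_lipschitz f ->
  forall x, exists2 L, 0 <= L & lipschitz_near f x L.
Proof.
move=> fL x; have [L [V /nbhs_eball[r r0 rV] h]] := fL x.
exists `|L| => //; exists r => // y z yr zr.
apply: le_trans (h _ _ (rV _ yr) (rV _ zr)) _.
by rewrite ler_wpM2r ?enorm_ge0// ler_norm.
Qed.

Lemma lipschitz_near_near f x L : lipschitz_near f x L ->
  exists2 r, 0 < r & forall z, enorm (z - x) <= r -> lipschitz_near f z L.
Proof.
move=> [r r0 h]; exists (r / 2); first lra.
move=> z zx; exists (r / 2); first lra.
move=> y y' yz yz'; apply: h.
  by have := ler_enormD (y - z) (z - x); rewrite addrA subrK; lra.
by have := ler_enormD (y' - z) (z - x); rewrite addrA subrK; lra.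
Qed.

Lemma lipschitz_quot_le f x L v :
  lipschitz_near f x L -> quot_le f x v (L * enorm v).
Proof.
move=> [r r0 h]; have v0 : 0 < enorm v + 1 by have := enorm_ge0 v; lra.
exists (Num.min (r / 2) (r / 2 / (enorm v + 1))).
  by rewrite lt_min !divr_gt0.
move=> y t; rewrite !le_min => /andP[yr _] /and3P[t0 _ tv].
apply: le_trans (ler_norm _) _.
have yv : enorm (y + t *: v - x) <= r.
  rewrite addrAC; apply: le_trans (ler_enormD _ _) _.
  rewrite enormZ gtr0_norm//; move: tv; rewrite ler_pdivlMr//; nra.
apply: le_trans (h _ _ yv _) _; first lra.
by rewrite addrAC subrr add0r enormZ gtr0_norm// mulrCA.
Qed.

(** Evaluate the quotient at [x] itself. *)
Lemma quot_le_ge f x L v a : lipschitz_near f x L -> quot_le f x v a ->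
  - (L * enorm v) <= a.
Proof.
move=> [r r0 h] [s s0 k].
have v0 : 0 < enorm v + 1 by have := enorm_ge0 v; lra.
pose t := Num.min s (r / (enorm v + 1)).
have t0 : 0 < t by rewrite lt_min s0 divr_gt0.
have ts : t <= s by rewrite ge_min lexx.
have tv : t * enorm v <= r.
  have : t <= r / (enorm v + 1) by rewrite ge_min lexx orbT.
  by rewrite ler_pdivlMr//; nra.
have xx : enorm (x - x) = 0 by rewrite subrr enorm0.
have := k x t; rewrite xx t0 ts => /(_ (ltW s0) isT) kt.
have yx : enorm (x + t *: v - x) = t * enorm v.
  by rewrite addrAC subrr add0r enormZ gtr0_norm.
have := h (x + t *: v) x; rewrite xx yx => /(_ tv (ltW r0)).
by rewrite ler_norml => /andP[ht _]; rewrite -(ler_pM2l t0); lra.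
Qed.

(** The real value of [clarke_dirderiv], which is finite for a function that is
    Lipschitz near [x]. *)
Definition dirderiv f x v : R := inf [set a | quot_le f x v a].

Lemma dirderiv_le f x L v a : lipschitz_near f x L ->
  quot_le f x v a -> dirderiv f x v <= a.
Proof.
move=> fL q; apply: ge_inf => //; exists (- (L * enorm v)) => b /= qb.
exact: quot_le_ge fL qb.
Qed.

Lemma dirderiv_ge f x L v b : lipschitz_near f x L ->
  (forall a, quot_le f x v a -> b <= a) -> b <= dirderiv f x v.
Proof.
move=> fL h; apply: lb_le_inf => [|a /= /h//].
by exists (L * enorm v); exact: lipschitz_quot_le.
Qed.

Lemma dirderiv_lt f x L v a :
  lipschitz_near f x L -> dirderiv f x v < a -> quot_le f x v a.
Proof.
move=> fL /inf_lt[|b /= qb /ltW ba]; last exact: quot_leW ba qb.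
by exists (L * enorm v); exact: lipschitz_quot_le.
Qed.

Lemma sublinear_dirderiv f x L :
  lipschitz_near f x L -> sublinear (dirderiv f x).
Proof.
move=> fL; split=> [v w|s v s0].
  rewrite -lerBlDr; apply: (dirderiv_ge fL) => a qa; rewrite lerBlDr -lerBlDl.
  apply: (dirderiv_ge fL) => b qb; rewrite lerBlDl.
  exact: dirderiv_le fL (quot_leD qa qb).
rewrite -ler_pdivrMl//; apply: (dirderiv_ge fL) => a qa; rewrite ler_pdivrMl//.
exact: dirderiv_le fL (quot_leZ s0 qa).
Qed.

(** The directional derivative is the support function of the subdifferential;
    in particular the subdifferential is nonempty. *)
Lemma clarke_subdiff_max f x v : locally_lipschitz f ->
  exists2 xi, clarke_subdiff f x xi & dotp xi v = dirderiv f x v.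
Proof.
move=> /locally_lipschitz_near/(_ x)[L _ fL].
have [xi [h e]] := Hahn_Banach_rV v (sublinear_dirderiv fL).
exists xi => //; apply/clarke_subdiffP => w a q.
exact: le_trans (h w) (dirderiv_le fL q).
Qed.

(** The bound [f°(x; v) <= L |v|] is used at [v = xi]. *)
Lemma clarke_subdiff_enorm f x L xi : 0 <= L -> lipschitz_near f x L ->
  clarke_subdiff f x xi -> enorm xi <= L.
Proof.
move=> L0 fL /clarke_subdiffP/(_ _ _ (lipschitz_quot_le xi fL)).
rewrite -enorm_sqr expr2; have [xi0|] := ltP 0 (enorm xi).
  by rewrite ler_pM2r.
by move=> /le_trans h _; exact: h.
Qed.

Lemma closed_clarke_subdiff f x : closed (clarke_subdiff f x).
Proof.
have -> : clarke_subdiff f x =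
    \bigcap_(p in [set p | quot_le f x p.1 p.2]) [set xi | dotp xi p.1 <= p.2].
  apply/seteqP; split=> xi.
    by move=> /clarke_subdiffP h [v a] /= q; exact: h.
  by move=> h; apply/clarke_subdiffP => v a q; exact: (h (v, a)).
apply: closed_bigI => -[v a] _ /=.
apply: (preimage_closed _ (@closed_le _ a)) => u _; exact: dotp_continuousl.
Qed.

(** A pair outside the graph violates some bound [<xi, v> <= a]; by
    [quot_le_near] the same bound is violated at all nearby pairs. *)
Lemma closed_clarke_graph f :
  closed [set p : 'rV[R]_n * 'rV[R]_n | clarke_subdiff f p.1 p.2].
Proof.
move=> [x xi] cl /=; apply/clarke_subdiffP => v a q.
rewrite leNgt; apply/negP => lt.
have [r r0 rq] := quot_le_near q.
have /cl[[z ze] /= [/clarke_subdiffP hz [/= zx zv]]] :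
    nbhs (x, xi) ([set y | enorm (y - x) < r] `*` [set u | a < dotp u v]).
  exists ([set y | enorm (y - x) < r], [set u | a < dotp u v]) => //=.
  split; first exact: enorm_near.
  exact: (cvgr_gt _ (@dotp_continuousl _ _ v xi)).
by have := hz _ _ (rq _ (ltW zx)); lra.
Qed.

End Clarke.

(** * The Goldstein subdifferential *)

Section Goldstein.
Set Implicit Arguments.
Unset Strict Implicit.
Context {R : realType} {n : nat}.
Context {f : 'rV[R]_n -> R} (f_lip : locally_lipschitz f).
Implicit Types (u v w x y z xi g : 'rV[R]_n) (a b r t e M : R).

(** The Lipschitz constant valid near a point bounds the subdifferentials near
    it, and the closed ball is covered by finitely many such neighborhoods. *)
Lemma clarke_subdiff_bounded x r : exists M, forall z xi,
  enorm (z - x) <= r -> clarke_subdiff f z xi -> enorm xi <= M.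
Proof.
have /compact_near_coveringP/near_covering_withinP cov :=
  @eball_compact R n x r.
have : \forall M \near +oo, [set z | enorm (z - x) <= r] `<=`
    [set z | forall xi, clarke_subdiff f z xi -> enorm xi <= M].
  apply: cov => z _; have [L L0 /lipschitz_near_near[s s0 fL]] :=
    locally_lipschitz_near f_lip z.
  near=> y M => _ xi.
  have LM : L <= M by near: M; apply: nbhs_pinfty_ge; exact: num_real.
  have yz : enorm (y - z) < s by near: y; exact: enorm_near.
  move=> /(clarke_subdiff_enorm L0 (fL _ (ltW yz)))/le_trans; exact.
move=> /filter_ex[M h]; exists M => z xi zx; exact: h.
Unshelve. all: by end_near. Qed.

(** It is the projection of a bounded part of the closed graph. *)
Lemma compact_clarke_union x r :
  compact (\bigcup_(z in [set z | enorm (z - x) <= r]) clarke_subdiff f z).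
Proof.
have [M hM] := clarke_subdiff_bounded x r.
pose P : set ('rV[R]_n * 'rV[R]_n) :=
  ([set z | enorm (z - x) <= r] `*` [set xi | enorm (xi - 0) <= M]) `&`
  [set p | clarke_subdiff f p.1 p.2].
have cP : compact P.
  apply: compact_closedI; last exact: closed_clarke_graph.
  by apply: compact_setX; exact: eball_compact.
suff -> : \bigcup_(z in [set z | enorm (z - x) <= r]) clarke_subdiff f z =
    snd @` P.
  apply: continuous_compact => //; apply: continuous_subspaceT => p.
  exact: cvg_snd.
apply/seteqP; split=> [xi [z /= zx zxi]|_ [[z xi] /= [[/= zx _] zxi] <-]].
  exists (z, xi) => //; split => //; split => //=.
  by rewrite subr0; exact: hM zxi.
by exists z.
Qed.

Lemma goldstein_min_norm_set1 x e : 0 <= e ->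
  exists g, goldstein_min_norm f x e = [set g].
Proof.
move=> e0; have [||g gm] := @argmin_norm_closed R n (goldstein_subdiff f e x).
- apply: compact_closed; first exact: norm_hausdorff.
  exact/compact_conv_hull/compact_clarke_union.
- have [xi xxi _] := clarke_subdiff_max x 0 f_lip.
  by exists xi; apply: sub_conv_hull; exists x => //=; rewrite subrr enorm0.
by exists g; apply: argmin_norm_set1 => //; exact: conv_hull_convex.
Qed.

Lemma goldstein_bounded x e :
  exists M, forall z xi, enorm (z - x) <= 1 -> goldstein_subdiff f e z xi ->
    enorm xi <= M.
Proof.
have [M hM] := clarke_subdiff_bounded x (e + 1); exists M => z xi zx.
suff: goldstein_subdiff f e z `<=` [set u | enorm u <= M] by apply.
apply: conv_hull_sub; first exact: convex_eball.
move=> u [y /= yz]; apply: hM.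
by have := ler_enormD (y - z) (z - x); rewrite addrA subrK; lra.
Qed.

(** The bound on the quotients persists at the points near [x], where it bounds
    the Clarke subdifferentials and with them their convex hull. *)
Lemma goldstein_halfspace x v a : quot_le f x v a ->
  exists2 r, 0 < r & forall z e xi, enorm (z - x) <= r -> e <= r ->
    goldstein_subdiff f e z xi -> dotp xi v <= a.
Proof.
move=> /quot_le_near[r r0 h]; exists (r / 2); first lra.
move=> z e xi zx er.
suff: goldstein_subdiff f e z `<=` [set u | dotp u v <= a] by apply.
apply: conv_hull_sub; first exact: convex_halfspace.
move=> u [y /= yz /clarke_subdiffP]; apply; apply: h.
by have := ler_enormD (y - z) (z - x); rewrite addrA subrK; lra.
Qed.

Lemma within_infinite_proper (N : set nat) :
  infinite_set N -> ProperFilter (within N \oo).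
Proof.
move=> iN; apply: Build_ProperFilter => -[m _ h].
apply: iN; apply: sub_finite_set (finite_II m) => k Nk /=.
by rewrite ltnNge; apply/negP => mk; exact: (h k mk Nk).
Qed.

Lemma limsup_goldstein_min_norm_sub x :
  limsup_eps0_x (goldstein_min_norm f) x `<=` clarke_subdiff f x.
Proof.
move=> u [xk [ek [xkx ek0 eke [N iN [w Gw wu]]]]].
apply/clarke_subdiffP => v a /goldstein_halfspace[r r0 h].
have FN := within_infinite_proper iN.
have : dotp (w k) v @[k --> within N \oo] --> dotp u v.
  by apply: dotp_cvg => //; exact: cvg_cst.
move=> /cvgr_to_le; apply.
have xr : \forall k \near \oo, enorm (xk k - x) < r.
  exact: (xkx _ (@enorm_near _ _ x _ r0)).
have er : \forall k \near \oo, ek k < r by exact: (cvgr_lt _ eke r r0).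
suff : \forall k \near \oo, N k -> dotp (w k) v <= a by [].
apply: filterS2 xr er => k /ltW xr /ltW er Nk.
exact: h xr er (Gw k Nk).1.
Qed.

(** With [b := d^2 / 2], a limit [w] satisfies [|w| <= |g|] and
    [<w, g> >= |g|^2 - b], so that [|w - g|^2 <= 2 b = d^2]. *)
Lemma goldstein_min_norm_near x g (d : R) :
  argmin_norm (clarke_subdiff f x) g ->
  0 < d -> exists2 r, 0 < r & forall e w, 0 < e <= r ->
    limsup_x (goldstein_min_norm f) x e w -> enorm (w - g) <= d.
Proof.
move=> gm d0; pose b := d ^+ 2 / 2.
have b0 : 0 < b by rewrite divr_gt0// exprn_gt0.
have [L _ fL] := locally_lipschitz_near f_lip x.
have /(dirderiv_lt fL)/goldstein_halfspace[r r0 h] :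
    dirderiv f x (- g) < - dotp g g + b.
  have [xi xxi <-] := clarke_subdiff_max x (- g) f_lip.
  rewrite dotpE dotpC.
  by have := argmin_norm_dotp (@convex_clarke_subdiff R n f x) gm xxi; lra.
exists r => // e w /andP[e0 er] [xk xkx [N iN [wk Gw wkw]]].
have FN := within_infinite_proper iN.
have xr : \forall k \near \oo, enorm (xk k - x) < Num.min e r.
  by apply: (xkx _ (@enorm_near _ _ x _ _)); rewrite lt_min e0.
(* [g] belongs to the Goldstein subdifferentials at the points [xk k] *)
have ww : dotp w w <= dotp g g.
  have : dotp (wk k) (wk k) @[k --> within N \oo] --> dotp w w.
    exact: dotp_cvg.
  move=> /cvgr_to_le; apply.
  suff : \forall k \near \oo, N k -> dotp (wk k) (wk k) <= dotp g g by [].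
  apply: filterS xr => k; rewrite lt_min => /andP[xe _] Nk.
  have [_ kmin] := Gw k Nk.
  rewrite -le_enorm; apply: kmin; apply: sub_conv_hull.
  exists x; last exact: gm.1.
  by rewrite /= -enormN opprB ltW.
have wg : dotp w (- g) <= - dotp g g + b.
  have : dotp (wk k) (- g) @[k --> within N \oo] --> dotp w (- g).
    by apply: dotp_cvg => //; exact: cvg_cst.
  move=> /cvgr_to_le; apply.
  suff : \forall k \near \oo, N k -> dotp (wk k) (- g) <= - dotp g g + b by [].
  apply: filterS xr => k; rewrite lt_min => /andP[_ /ltW xr] Nk.
  exact: h xr er (Gw k Nk).1.
rewrite -(@ler_pXn2r _ 2) ?nnegrE ?enorm_ge0 ?(ltW d0)// enorm_sqr.
by move: wg; rewrite /b !dotpE (dotpC g w); lra.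
Qed.

(** Every selection of the sets [A k] converges to [g]. *)
Lemma set_limit_set1 (A : nat -> set 'rV[R]_n) g :
  (forall k, A k !=set0) ->
  (forall d : R, 0 < d ->
     \forall k \near \oo, forall w, A k w -> enorm (w - g) <= d) ->
  set_limit A [set g].
Proof.
move=> A0 Ag.
have cv (N : set nat) (w : nat -> 'rV[R]_n) : (forall k, N k -> A k (w k)) ->
    w @ within N \oo --> g.
  move=> Nw V /nbhs_eball[d d0 dV]; have := Ag d d0.
  by apply: filterS => k h Nk; apply: dV; exact/h/Nw.
have [w Aw] := choice A0.
have sub : outer_limit A `<=` [set g].
  move=> u [N iN [w' Nw' w'u]]; have FN := within_infinite_proper iN.
  exact: (cvg_unique (@norm_hausdorff _ _) w'u (cv _ _ Nw')).
have io : inner_limit A `<=` outer_limit A.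
  move=> u [N fN h]; exists N => // fN'; apply: infinite_nat.
  by rewrite -(setUv N) finite_setU.
have gi : [set g] `<=` inner_limit A.
  move=> _ ->; exists setT; first by rewrite setCT.
  by exists w => //; exact: cv.
split; apply/seteqP; split => //.
- exact: subset_trans gi io.
- exact: subset_trans io sub.
Qed.

Lemma goldstein_min_norm_set_limit x :
  set_limit_eps0 (limsup_x (goldstein_min_norm f) x)
    (argmin_norm (clarke_subdiff f x)).
Proof.
move=> e e0 ecv.
have [g gm] : argmin_norm (clarke_subdiff f x) !=set0.
  apply: argmin_norm_closed; first exact: closed_clarke_subdiff.
  by have [xi ? _] := clarke_subdiff_max x 0 f_lip; exists xi.
rewrite (argmin_norm_set1 (@convex_clarke_subdiff R n f x) gm).
apply: set_limit_set1 => [k|d d0].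
  (* the constant sequence [x] shows that the outer limit is nonempty *)
  have [h hE] := goldstein_min_norm_set1 x (ltW (e0 k)).
  exists h; exists (fun=> x); first exact: cvg_cst.
  exists setT; first exact: infinite_nat.
  by exists (fun=> h) => [j _|]; [rewrite hE|exact: cvg_cst].
have [r r0 h] := goldstein_min_norm_near gm d0.
have er : \forall k \near \oo, e k < r by exact: (cvgr_lt _ ecv r r0).
by apply: filterS er => k /ltW ekr w; apply: h; rewrite e0.
Qed.

End Goldstein.

(** * Descent-orientedness *)

Theorem proposition3 (R : realType) (n : nat) (f : 'rV[R]_n -> R)
    (f_lip : locally_lipschitz f) :
  (forall (x : 'rV[R]_n) (eps : R), 0 < eps ->
     exists g : 'rV[R]_n, goldstein_min_norm f x eps = [set g]) /\
  descent_oriented f (goldstein_min_norm f).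
Proof.
split=> [x eps /ltW|]; first exact: goldstein_min_norm_set1.
split=> [eps e0 x|eps e0 x|x|x].
- have [g ->] := goldstein_min_norm_set1 f_lip x (ltW e0).
  exact/accessible_closed_set1/hausdorff_accessible/norm_hausdorff.
- have [M hM] := goldstein_bounded f_lip x eps.
  exists [set z | enorm (z - x) < 1]; first exact: enorm_near.
  exists M; split; first exact: num_real.
  move=> m /ltW Mm u [z /= /ltW zx [zu _]].
  apply: le_trans (mx_norm_le_enorm u) _; exact: le_trans (hM _ _ zx zu) Mm.
- exact: limsup_goldstein_min_norm_sub.
- exact: goldstein_min_norm_set_limit.
Qed.
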